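(* Let $f_1,f_2:\mathbb{R}^n\to\mathbb{R}$ be exact CN functions on $S$ (or weak uniform exact CN functions on $S$, or strong uniform exact CN functions on $S$), with $f_2(\bm x)\ne0$ for all $\bm x\in S_1$. Then $\frac{f_1}{f_2}$ is a weak uniform exact CN function on $S$.
   Context: Let $S_1\subset\mathbb{R}^n$ be a convex set. A function $f$ with values in $\mathbb{R}$ is a CN (convertible nonconvex) function on $S$ if there are $m$, a convex set $S=S_1\times S_2\subset\mathbb{R}^n\times\mathbb{R}^m$, and functions $g,g_1,\dots,g_r:\mathbb{R}^n\times\mathbb{R}^m\to\mathbb{R}$ ($r\ge1$), all convex on $S$, such that, with $X(\bm g)=\{(\bm x,\bm y)\in S: g_i(\bm x,\bm y)=0,\ i=1,\dots,r\}$, for each $\bm x\in S_1$ there is $\bm y\in\mathbb{R}^m$ with $(\bm x,\bm y)\in X(\bm g)$ and $f(\bm x)=g(\bm x,\bm y)=\min_{(\bm x,\bm y')\in X(\bm g)}g(\bm x,\bm y')$ (only the values of $f$ on $S_1$ matter). It is an exact CN function on $S$ if such data exist for which, moreover, for each $\bm x\in S_1$ there is $\bm y$ with $(\bm x,\bm y)\in X(\bm g)$ and $f(\bm x)=g(\bm x,\bm y)=g(\bm x,\bm y')$ for all $\bm y'$ with $(\bm x,\bm y')\in X(\bm g)$. A CN (resp. exact CN) function is weak uniform (resp. strong uniform) if in such data $g$ can be chosen weak uniform convex (resp. strong uniform convex) on $S$: $g$ is differentiable and for every $\bm w\in S$ there is a positive semidefinite (resp. positive definite) symmetric matrix $B(\bm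 w)$ with $g(\bm w+\bm d)-g(\bm w)\ge\nabla g(\bm w)^\top\bm d+\frac12\bm d^\top B(\bm w)\bm d$ for all $\bm d$ with $\bm w+\bm d\in S$. When ''on $S$'' is asserted of several functions, $S_1$ is the same for all of them, while the number $m$ of auxiliary variables and the factor $S_2$ may differ from function to function. *)

(* Defs.v *)
From HB Require Import structures.
From mathcomp Require Import all_boot all_order all_algebra.
From mathcomp Require Import all_classical all_reals all_analysis.

Set Implicit Arguments.
Unset Strict Implicit.
Unset Printing Implicit Defensive.

Import Order.TTheory GRing.Theory Num.Theory.
Import numFieldNormedType.Exports.

Local Open Scope classical_set_scope.
Local Open Scope ring_scope.

(* Points of R^n are row vectors, and the point (x, y) of R^n x R^m is
   [row_mx x y : 'rV_(n + m)]. *)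

Definition prod_set (R : realType) (n m : nat)
    (S1 : set 'rV[R]_n) (S2 : set 'rV[R]_m) : set 'rV[R]_(n + m) :=
  [set row_mx x y | x in S1 & y in S2].

Definition dotprod (R : realType) (k : nat) (u v : 'rV[R]_k) : R :=
  (u *m v^T) 0 0.

Definition quadform (R : realType) (k : nat) (B : 'M[R]_k) (d : 'rV[R]_k) : R :=
  (d *m B *m d^T) 0 0.

Definition possemidef (R : realType) (k : nat) (B : 'M[R]_k) : Prop :=
  B^T = B /\ forall d : 'rV[R]_k, 0 <= quadform B d.

Definition posdef (R : realType) (k : nat) (B : 'M[R]_k) : Prop :=
  B^T = B /\ forall d : 'rV[R]_k, d != 0 -> 0 < quadform B d.

Definition grad (R : realType) (k : nat) (g : 'rV[R]_k -> R) (w : 'rV[R]_k) :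
    'rV[R]_k :=
  \row_j 'D_(delta_mx 0 j) g w.

Definition uniform_convex_with (R : realType) (k : nat)
    (P : 'M[R]_k -> Prop) (S : set 'rV[R]_k) (g : 'rV[R]_k -> R) : Prop :=
  (forall w, differentiable g w) /\
  forall w, S w -> exists B : 'M[R]_k, P B /\
    forall d, S (w + d) ->
      g (w + d) - g w >= dotprod (grad g w) d + 2^-1 * quadform B d.

Definition weak_uniform_convex (R : realType) (k : nat) :=
  uniform_convex_with (@possemidef R k).

Definition strong_uniform_convex (R : realType) (k : nat) :=
  uniform_convex_with (@posdef R k).

(* The set X(g_1, ..., g_r). *)
Definition feasible (R : realType) (k r : nat) (S : set 'rV[R]_k)
    (gs : 'I_r -> 'rV[R]_k -> R) : set 'rV[R]_k :=
  [set w | S w /\ forall i, gs i w = 0].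

Definition CN_data (R : realType) (n : nat) (S1 : set 'rV[R]_n)
    (f : 'rV[R]_n -> R) (m : nat) (S2 : set 'rV[R]_m)
    (g : 'rV[R]_(n + m) -> R) (r : nat) (gs : 'I_r -> 'rV[R]_(n + m) -> R) :
    Prop :=
  let S := prod_set S1 S2 in
  let X := feasible S gs in
  [/\ (0 < r)%N, convex_set S, convex_function S g,
      forall i, convex_function S (gs i) &
      forall x, S1 x -> exists y : 'rV[R]_m,
        [/\ X (row_mx x y), f x = g (row_mx x y) &
            forall y' : 'rV[R]_m,
              X (row_mx x y') -> g (row_mx x y) <= g (row_mx x y')]].

Definition exact_CN_data (R : realType) (n : nat) (S1 : set 'rV[R]_n)
    (f : 'rV[R]_n -> R) (m : nat) (S2 : set 'rV[R]_m)
    (g : 'rV[R]_(n + m) -> R) (r : nat) (gs : 'I_r -> 'rV[R]_(n + m) -> R) :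
    Prop :=
  let X := feasible (prod_set S1 S2) gs in
  CN_data S1 f S2 g gs /\
  forall x, S1 x -> exists y : 'rV[R]_m,
    [/\ X (row_mx x y), f x = g (row_mx x y) &
        forall y' : 'rV[R]_m,
          X (row_mx x y') -> g (row_mx x y) = g (row_mx x y')].

(* "On S" only fixes the factor S1: the number m of auxiliary variables and
   the factor S2 are part of the existentially quantified data. *)
Definition exact_CN (R : realType) (n : nat) (S1 : set 'rV[R]_n)
    (f : 'rV[R]_n -> R) : Prop :=
  exists (m : nat) (S2 : set 'rV[R]_m) (g : 'rV[R]_(n + m) -> R) (r : nat)
    (gs : 'I_r -> 'rV[R]_(n + m) -> R),
    exact_CN_data S1 f S2 g gs.

Definition weak_uniform_exact_CN (R : realType) (n : nat) (S1 : set 'rV[R]_n)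
    (f : 'rV[R]_n -> R) : Prop :=
  exists (m : nat) (S2 : set 'rV[R]_m) (g : 'rV[R]_(n + m) -> R) (r : nat)
    (gs : 'I_r -> 'rV[R]_(n + m) -> R),
    exact_CN_data S1 f S2 g gs /\ weak_uniform_convex (prod_set S1 S2) g.

Definition strong_uniform_exact_CN (R : realType) (n : nat)
    (S1 : set 'rV[R]_n) (f : 'rV[R]_n -> R) : Prop :=
  exists (m : nat) (S2 : set 'rV[R]_m) (g : 'rV[R]_(n + m) -> R) (r : nat)
    (gs : 'I_r -> 'rV[R]_(n + m) -> R),
    exact_CN_data S1 f S2 g gs /\ strong_uniform_convex (prod_set S1 S2) g.

(* Main.v *)
Require Import Defs.
From HB Require Import structures.
From mathcomp Require Import all_boot all_order all_algebra.
From mathcomp Require Import all_classical all_reals all_analysis.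
From mathcomp Require Import lra ring.

Set Implicit Arguments.
Unset Strict Implicit.
Unset Printing Implicit Defensive.

Import Order.TTheory GRing.Theory Num.Theory.
Import numFieldNormedType.Exports.

Local Open Scope classical_set_scope.
Local Open Scope ring_scope.
Local Open Scope convex_scope.

(** Exactness says that the objective has the same value at all feasible points
    above a given x, so the equation t = f x between variables can be enforced
    by constraints: the constraints of f together with g - t = 0, which is
    convex because t enters linearly. The given data of f1 and f2 use different
    auxiliary variables y1 and y2; since exactness concerns every feasible
    point, stacking (y1, y2) and imposing both systems of constraints leaves
    each objective equal to its function ([exact_CN_common]).

    It remains to express a quotient by equations p = 0 with p convex, although
    q * t = f1 x is bilinear. Introduce three real variables q, t and v with

      g2 - t = 0,   (q + t)^2 - v = 0,   q^2 + t^2 + 2 g1 - v = 0.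

    Every left-hand side is a sum of convex functions, squares of linear forms
    and linear forms. The first equation says t = f2 x, and the difference of
    the other two says q t = g1 = f1 x, so that q = f1 x / f2 x. The objective
    is then the coordinate q alone, which is linear and hence weak uniform convex
    with B = 0 ([exact_CN_data_div]). Each of the three possible hypotheses on f1
    and f2 provides exact data, from which this construction starts. *)

(** * Convex functions *)

Lemma linear_conv (R : realType) (E F : lmodType R) (h : E -> F)
    (t : {i01 R}) (u v : convex_lmodType E) :
  linear h ->
  h (u <| t |> v) =
    ((h u : convex_lmodType F) <| t |> (h v : convex_lmodType F)).
Proof.
move=> hl; have h0 : h 0 = 0.
  by have := hl (-1) 0 0; rewrite scaler0 addr0 scaleN1r addNr.
change (h (t%:num *: (u : E) + (1 - t%:num) *: (v : E)) =
  t%:num *: h u + (1 - t%:num) *: h v).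
by rewrite hl -[_ *: (v : E)]addr0 hl h0 addr0.
Qed.

Lemma convex_function_comp (R : realType) (E F : lmodType R) (h : E -> F)
    (S : set E) (D : set F) (f : F -> R) :
  linear h -> (forall w, S w -> D (h w)) ->
  convex_function D f -> convex_function S (fun w => f (h w)).
Proof.
move=> hl hSD fconv t u v; rewrite !inE => Su Sv /=.
by rewrite linear_conv//; apply: fconv; rewrite inE; exact: hSD.
Qed.

Lemma convex_functionD (R : realType) (E : lmodType R) (S : set E)
    (f g : E -> R) :
  convex_function S f -> convex_function S g ->
  convex_function S (fun w => f w + g w).
Proof.
move=> fconv gconv t u v uS vS /=.
have := fconv t u v uS vS; have := gconv t u v uS vS.
by rewrite !convRE; lra.
Qed.

Lemma convex_function_scalar (R : realType) (E : lmodType R) (S : set E)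
    (l : E -> R) :
  scalar l -> convex_function S l.
Proof. by move=> ll t u v _ _; rewrite (@linear_conv _ _ R^o). Qed.

Lemma convex_function_sqr (R : realType) (E : lmodType R) (S : set E)
    (l : E -> R) :
  scalar l -> convex_function S (fun w => l w ^+ 2).
Proof.
move=> ll t u v _ _ /=; rewrite (@linear_conv _ _ R^o)//.
change ((t%:num * l u + (1 - t%:num) * l v) ^+ 2 <=
  t%:num * l u ^+ 2 + (1 - t%:num) * l v ^+ 2).
have t0 : 0 <= t%:num :> R by [].
have t1 : t%:num <= 1 :> R by [].
(* The defect of convexity of the square along a segment. *)
rewrite -subr_ge0 [X in 0 <= X](_ : _ =
  t%:num * (1 - t%:num) * (l u - l v) ^+ 2); last by ring.
by rewrite mulr_ge0 ?sqr_ge0// mulr_ge0// subr_ge0.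
Qed.

(** * Linear objectives *)

(** A coordinate equals its first-order expansion, so B = 0 works. *)
Lemma weak_uniform_convex_coord (R : realType) (k : nat) (S : set 'rV[R]_k)
    (j : 'I_k) :
  weak_uniform_convex S (fun w => w 0 j).
Proof.
split=> [w|w _]; first exact: differentiable_coord.
have quadform0 d : quadform (0 : 'M[R]_k) d = 0.
  by rewrite /quadform mulmx0 mul0mx mxE.
exists 0; split=> [|d _]; first by split=> [|d]; rewrite ?trmx0 ?quadform0.
rewrite quadform0 mulr0 addr0.
rewrite [X in X <= _](_ : _ = d 0 j); first by rewrite mxE addrAC subrr add0r.
have gradE i : grad (fun u : 'rV[R]_k => u 0 j) w 0 i = (i == j)%:R.
  rewrite mxE /derive; apply: lim_near_cst => //.
  (* The difference quotient at a nonzero h does not depend on h. *)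
  near=> h; rewrite /= !mxE eqxx/= addrK /GRing.scale/= eq_sym.
  rewrite mulrA mulVf ?mul1r//.
  by near: h; exact: nbhs_dnbhs_neq.
rewrite /dotprod mxE (bigD1 j)//= gradE eqxx mul1r mxE big1 ?addr0// => i ij.
by rewrite gradE (negbTE ij) mul0r.
Unshelve. all: by end_near. Qed.

(** * Adding auxiliary variables *)

Lemma prod_set_row (R : realType) (n m : nat) (A : set 'rV[R]_n)
    (B : set 'rV[R]_m) (x : 'rV[R]_n) (y : 'rV[R]_m) :
  prod_set A B (row_mx x y) <-> A x /\ B y.
Proof.
split=> [[x' Ax'] [y' By'] /eq_row_mx[<- <-]//|[Ax By]].
by exists x => //; exists y.
Qed.

(** The auxiliary variables of combined data form a block (y, z); these maps
    forget one half of it, so that a function of (x, y) or of (x, z) can be read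
    as a function of (x, (y, z)). *)
Definition keep_left (R : realType) (n m k : nat) (w : 'rV[R]_(n + (m + k))) :
    'rV[R]_(n + m) :=
  row_mx (lsubmx w) (lsubmx (rsubmx w)).

Definition keep_right (R : realType) (n m k : nat) (w : 'rV[R]_(n + (m + k))) :
    'rV[R]_(n + k) :=
  row_mx (lsubmx w) (rsubmx (rsubmx w)).

Lemma keep_left_row (R : realType) (n m k : nat) (x : 'rV[R]_n)
    (y : 'rV[R]_m) (z : 'rV[R]_k) :
  keep_left (row_mx x (row_mx y z)) = row_mx x y.
Proof. by rewrite /keep_left row_mxKr !row_mxKl. Qed.

Lemma keep_right_row (R : realType) (n m k : nat) (x : 'rV[R]_n)
    (y : 'rV[R]_m) (z : 'rV[R]_k) :
  keep_right (row_mx x (row_mx y z)) = row_mx x z.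
Proof. by rewrite /keep_right !row_mxKr row_mxKl. Qed.

Lemma keep_left_linear (R : realType) (n m k : nat) :
  linear (@keep_left R n m k).
Proof.
by move=> a u v; rewrite /keep_left !linearP/= scale_row_mx add_row_mx.
Qed.

Lemma keep_right_linear (R : realType) (n m k : nat) :
  linear (@keep_right R n m k).
Proof.
by move=> a u v; rewrite /keep_right !linearP/= scale_row_mx add_row_mx.
Qed.

Lemma prod_set_keep (R : realType) (n m k : nat) (S1 : set 'rV[R]_n)
    (A : set 'rV[R]_m) (B : set 'rV[R]_k) (w : 'rV[R]_(n + (m + k))) :
  prod_set S1 (prod_set A B) w <->
  prod_set S1 A (keep_left w) /\ prod_set S1 B (keep_right w).
Proof.
rewrite -[w]hsubmxK -[rsubmx w]hsubmxK keep_left_row keep_right_row.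
by rewrite !prod_set_row; tauto.
Qed.

(** Obtained by intersecting the preimages of the two smaller products under
    the linear forgetful maps. Going through convexity of A and B would fail
    when S1 is empty: the products are then convex for arbitrary A and B. *)
Lemma convex_set_prod_set (R : realType) (n m k : nat) (S1 : set 'rV[R]_n)
    (A : set 'rV[R]_m) (B : set 'rV[R]_k) :
  convex_set (prod_set S1 A) -> convex_set (prod_set S1 B) ->
  convex_set (prod_set S1 (prod_set A B)).
Proof.
move=> cA cB u v t; rewrite !inE => /prod_set_keep[uA uB] /prod_set_keep[vA vB].
apply/prod_set_keep; rewrite (linear_conv _ _ _ (@keep_left_linear R n m k)).
rewrite (linear_conv _ _ _ (@keep_right_linear R n m k)).
by split; apply/set_mem; [apply: cA|apply: cB]; rewrite inE.
Qed.

Lemma convex_set_prod_setT (R : realType) (n m : nat) (S1 : set 'rV[R]_n) :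
  convex_set S1 -> convex_set (prod_set S1 (@setT 'rV[R]_m)).
Proof.
have prodE w : prod_set S1 (@setT 'rV[R]_m) w <-> S1 (lsubmx w).
  by rewrite -[in prod_set _ _ _](hsubmxK w) prod_set_row; split=> [[]|].
move=> cS1 u v t; rewrite !inE => /prodE uS /prodE vS; apply/prodE.
rewrite linear_conv; last exact: linearP.
by apply/set_mem/cS1; rewrite inE.
Qed.

(** * Families of constraints *)

Definition cat_family (T : Type) (r s : nat) (a : 'I_r -> T) (b : 'I_s -> T)
    (i : 'I_(r + s)) : T :=
  match fintype.split i with inl j => a j | inr j => b j end.

Lemma cat_familyP (T : Type) (P : T -> Prop) (r s : nat) (a : 'I_r -> T)
    (b : 'I_s -> T) :
  (forall i, P (cat_family a b i)) <->
  (forall i, P (a i)) /\ (forall j, P (b j)).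
Proof.
split=> [Pab|[Pa Pb] i]; last by rewrite /cat_family; case: (fintype.split i).
split=> [i|j].
- by have := Pab (unsplit (inl i)); rewrite /cat_family unsplitK.
- by have := Pab (unsplit (inr j)); rewrite /cat_family unsplitK.
Qed.

Definition family3 (T : Type) (a b c : T) (i : 'I_3) : T :=
  nth a [:: a; b; c] i.

Lemma family3P (T : Type) (P : T -> Prop) (a b c : T) :
  (forall i, P (family3 a b c i)) <-> [/\ P a, P b & P c].
Proof.
split=> [Pabc|[Pa Pb Pc] [[|[|[|i]]]]//].
by split; [have := Pabc (@Ordinal 3 0 isT)|have := Pabc (@Ordinal 3 1 isT)
  |have := Pabc (@Ordinal 3 2 isT)].
Qed.

(** * Exact data *)

(** An objective that is constant on the feasible points above x is minimal at
    each of them, with value f x. The last two clauses, solvability and the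
    computation of f at every feasible point, are the form of exactness that is
    stable under adding variables and constraints. *)
Lemma exact_CN_dataP (R : realType) (n : nat) (S1 : set 'rV[R]_n)
    (f : 'rV[R]_n -> R) (m : nat) (S2 : set 'rV[R]_m)
    (g : 'rV[R]_(n + m) -> R) (r : nat) (gs : 'I_r -> 'rV[R]_(n + m) -> R) :
  let S := prod_set S1 S2 in
  let X := feasible S gs in
  exact_CN_data S1 f S2 g gs <->
  [/\ (0 < r)%N /\ convex_set S, convex_function S g,
      forall i, convex_function S (gs i),
      forall x, S1 x -> exists y, X (row_mx x y) &
      forall x y, X (row_mx x y) -> g (row_mx x y) = f x].
Proof.
move=> S X; split=> [[[r0 cS cg cgs _] exact]|[[r0 cS] cg cgs solv val]].
  split=> // [x /exact[y [Xy _ _]]|x y Xxy]; first by exists y.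
  have [/prod_set_row[/exact[y' [_ -> constg]] _] _] := Xxy.
  exact/esym/constg.
have exact x : S1 x -> exists y : 'rV[R]_m, [/\ X (row_mx x y),
    f x = g (row_mx x y) &
    forall y', X (row_mx x y') -> g (row_mx x y) = g (row_mx x y')].
  move=> /solv[y Xy]; exists y; split=> // [|y' Xy']; first by rewrite val.
  by rewrite !val.
split=> //; split=> // x /exact[y [Xy fE constg]].
by exists y; split=> // y' /constg ->.
Qed.

(** Two exact functions can share their auxiliary variables and constraints:
    with y = (y1, y2) subject to both systems, g1 (x, y1) and g2 (x, y2) are
    still determined by x, since exactness holds at every feasible point. For
    CN functions in general, the constraints alone would not determine these
    values. *)
Lemma exact_CN_common (R : realType) (n : nat) (S1 : set 'rV[R]_n)
    (f1 f2 : 'rV[R]_n -> R) :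
  exact_CN S1 f1 -> exact_CN S1 f2 ->
  exists (m : nat) (S2 : set 'rV[R]_m) (r : nat)
    (gs : 'I_r -> 'rV[R]_(n + m) -> R) (g1 g2 : 'rV[R]_(n + m) -> R),
    exact_CN_data S1 f1 S2 g1 gs /\ exact_CN_data S1 f2 S2 g2 gs.
Proof.
move=> [m1 [A [g1 [r1 [gs1 /exact_CN_dataP[[r1_gt0 cA] cg1 cgs1 sol1 val1]]]]]].
move=> [m2 [B [g2 [r2 [gs2 /exact_CN_dataP[[r2_gt0 cB] cg2 cgs2 sol2 val2]]]]]].
pose left := @keep_left R n m1 m2; pose right := @keep_right R n m1 m2.
pose S := prod_set S1 (prod_set A B).
pose gs := cat_family (fun i w => gs1 i (left w)) (fun i w => gs2 i (right w)).
have cS : convex_set S by exact: convex_set_prod_set.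
have cleft (g : _ -> R) : convex_function (prod_set S1 A) g ->
    convex_function S (fun w => g (left w)).
  apply: convex_function_comp; first exact: keep_left_linear.
  by move=> w /prod_set_keep[].
have cright (g : _ -> R) : convex_function (prod_set S1 B) g ->
    convex_function S (fun w => g (right w)).
  apply: convex_function_comp; first exact: keep_right_linear.
  by move=> w /prod_set_keep[].
have cgs i : convex_function S (gs i).
  move: i; apply/(@cat_familyP _ (fun h => convex_function S h)).
  by split=> i; [apply: cleft|apply: cright].
have feasE x y1 y2 : feasible S gs (row_mx x (row_mx y1 y2)) <->
    feasible (prod_set S1 A) gs1 (row_mx x y1) /\
    feasible (prod_set S1 B) gs2 (row_mx x y2).
  rewrite /feasible/= /S prod_set_keep keep_left_row keep_right_row.
  rewrite (@cat_familyP _ (fun h => h _ = 0)) /left /right.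
  by rewrite keep_left_row keep_right_row; tauto.
have sol x : S1 x -> exists y, feasible S gs (row_mx x y).
  move=> S1x; have [y1 X1] := sol1 _ S1x; have [y2 X2] := sol2 _ S1x.
  by exists (row_mx y1 y2); apply/feasE.
exists (m1 + m2)%N, (prod_set A B), (r1 + r2)%N, gs.
exists (fun w => g1 (left w)), (fun w => g2 (right w)).
split; apply/exact_CN_dataP; split=> //.
- by rewrite addn_gt0 r1_gt0.
- exact: cleft.
- move=> x y; rewrite -[y]hsubmxK /left keep_left_row => /feasE[X1 _].
  exact: val1.
- by rewrite addn_gt0 r1_gt0.
- exact: cright.
- move=> x y; rewrite -[y]hsubmxK /right keep_right_row => /feasE[_ X2].
  exact: val2.
Qed.

(** * Quotients *)

(** The bilinear equation q * t = g1 is the difference of the two convex ones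
    (q + t)^2 = v and q^2 + t^2 + 2 g1 = v. Here g1 enters with a positive sign,
    hence convexly. *)
Lemma exact_CN_data_div (R : realType) (n : nat) (S1 : set 'rV[R]_n)
    (f1 f2 : 'rV[R]_n -> R) (m : nat) (S2 : set 'rV[R]_m) (r : nat)
    (gs : 'I_r -> 'rV[R]_(n + m) -> R) (g1 g2 : 'rV[R]_(n + m) -> R) :
  convex_set S1 -> (forall x, S1 x -> f2 x != 0) ->
  exact_CN_data S1 f1 S2 g1 gs -> exact_CN_data S1 f2 S2 g2 gs ->
  weak_uniform_exact_CN S1 (fun x => f1 x / f2 x).
Proof.
move=> cS1 f2N0.
move=> /exact_CN_dataP[[r_gt0 cS2] cg1 cgs sol val1].
move=> /exact_CN_dataP[_ cg2 _ _ val2].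
pose S2' := prod_set S2 (@setT 'rV[R]_3); pose S := prod_set S1 S2'.
pose old := @keep_left R n m 3.
pose i0 : 'I_3 := @Ordinal 3 0 isT; pose i1 : 'I_3 := @Ordinal 3 1 isT.
pose i2 : 'I_3 := @Ordinal 3 2 isT.
pose z (k : 'I_3) : 'I_(n + (m + 3)) := rshift n (rshift m k).
pose q (w : 'rV[R]_(n + (m + 3))) := w 0 (z i0).
pose t (w : 'rV[R]_(n + (m + 3))) := w 0 (z i1).
pose v (w : 'rV[R]_(n + (m + 3))) := w 0 (z i2).
pose c1 w := g2 (old w) - t w.
pose c2 w := (q w + t w) ^+ 2 - v w.
pose c3 w := q w ^+ 2 + t w ^+ 2 + (g1 (old w) + g1 (old w)) - v w.
pose gs' := cat_family (fun i w => gs i (old w)) (family3 c1 c2 c3).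
have cold (g : _ -> R) : convex_function (prod_set S1 S2) g ->
    convex_function S (fun w => g (old w)).
  apply: convex_function_comp; first exact: keep_left_linear.
  by move=> w /prod_set_keep[].
have coordN j : scalar (fun w : 'rV[R]_(n + (m + 3)) => - w 0 j).
  by move=> a u w; rewrite !mxE opprD mulrN.
have cc1 : convex_function S c1.
  by apply: convex_functionD;
    [exact: cold|exact: (convex_function_scalar (coordN _))].
have cc2 : convex_function S c2.
  apply: convex_functionD; last exact: (convex_function_scalar (coordN _)).
  by apply: convex_function_sqr => a u w; rewrite /q /t !mxE; ring.
have cc3 : convex_function S c3.
  apply: convex_functionD; last exact: (convex_function_scalar (coordN _)).
  apply: convex_functionD; last by apply: convex_functionD; exact: cold.
  by apply: convex_functionD; apply: convex_function_sqr => a u w;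
    rewrite /q /t !mxE.
have feasE x y d : feasible S gs' (row_mx x (row_mx y d)) <->
    feasible (prod_set S1 S2) gs (row_mx x y) /\
    [/\ g2 (row_mx x y) - d 0 i1 = 0,
        (d 0 i0 + d 0 i1) ^+ 2 - d 0 i2 = 0 &
        d 0 i0 ^+ 2 + d 0 i1 ^+ 2 + (g1 (row_mx x y) + g1 (row_mx x y))
          - d 0 i2 = 0].
  rewrite /feasible/= /S prod_set_keep keep_left_row keep_right_row.
  rewrite (@cat_familyP _ (fun h => h _ = 0)) (@family3P _ (fun h => h _ = 0)).
  rewrite /c1 /c2 /c3 /q /t /v /z /old keep_left_row !row_mxEr !prod_set_row.
  have dT : [set: 'rV[R]_3] d by [].
  by tauto.
exists (m + 3)%N, S2', q, (r + 3)%N, gs'; split; last first.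
  exact: weak_uniform_convex_coord.
apply/exact_CN_dataP; split.
- split; first by rewrite addn_gt0 r_gt0.
  by apply: convex_set_prod_set => //; exact: convex_set_prod_setT.
- by apply: convex_function_scalar => a u w; rewrite /q !mxE.
- move=> i; move: i; apply/(@cat_familyP _ (fun h => convex_function S h)).
  split=> [i|]; first exact: cold.
  exact/(@family3P _ (fun h => convex_function S h)).
- move=> x S1x; have [y Xy] := sol _ S1x.
  pose qx := f1 x / f2 x.
  exists (row_mx y (\row_k family3 qx (f2 x) ((qx + f2 x) ^+ 2) k)).
  apply/feasE; split=> //; rewrite !mxE /family3/= (val1 _ _ Xy) (val2 _ _ Xy).
  have f2x := f2N0 _ S1x.
  by rewrite /qx; split; field.
- move=> x y; rewrite -[y]hsubmxK => /feasE[Xy [c1E c2E c3E]].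
  have [/prod_set_row[/f2N0 f2x _] _] := Xy.
  move: c1E c2E c3E; rewrite (val1 _ _ Xy) (val2 _ _ Xy).
  rewrite /q /z !row_mxEr; set d := rsubmx y.
  move=> /eqP; rewrite subr_eq0 => /eqP <- c2E c3E.
  (* With f2 x for t, subtracting c2E from c3E gives 2 q (f2 x) = 2 (f1 x). *)
  apply: (mulIf f2x); rewrite divfK//.
  by lra.
Qed.

Theorem proposition2p6 (R : realType) (n : nat) (S1 : set 'rV[R]_n)
    (f1 f2 : 'rV[R]_n -> R)
    (hS1 : convex_set S1)
    (hf : [\/ exact_CN S1 f1 /\ exact_CN S1 f2,
              weak_uniform_exact_CN S1 f1 /\ weak_uniform_exact_CN S1 f2 |
              strong_uniform_exact_CN S1 f1 /\ strong_uniform_exact_CN S1 f2])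
    (hf2 : forall x, S1 x -> f2 x != 0) :
  weak_uniform_exact_CN S1 (fun x => f1 x / f2 x).
Proof.
have weak f : weak_uniform_exact_CN S1 f -> exact_CN S1 f.
  by move=> [m [S2 [g [r [gs [data _]]]]]]; exists m, S2, g, r, gs.
have strong f : strong_uniform_exact_CN S1 f -> exact_CN S1 f.
  by move=> [m [S2 [g [r [gs [data _]]]]]]; exists m, S2, g, r, gs.
have [ex1 ex2] : exact_CN S1 f1 /\ exact_CN S1 f2.
  by case: hf => -[h1 h2]; split; auto.
have [m [S2 [r [gs [g1 [g2 [data1 data2]]]]]]] := exact_CN_common ex1 ex2.
exact: exact_CN_data_div data1 data2.
Qed.
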